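(* Let $n\geq 5$ and let $\pi=(d_1,d_2,\ldots,d_n)$ be a graphic sequence with $d_1\geq d_2\geq\cdots\geq d_n\geq 0$. Then $\pi$ is potentially $K_5-A_3$-graphic if and only if all of the following hold: (1) $d_4\geq 3$ and $d_5\geq 2$; (2) $\pi\neq(n-1,3^3,2^{n-k},1^{k-4})$ whenever $n\geq 6$ and $k\in\{4,5,\ldots,n-2\}$ with $n$ and $k$ of the same parity; (3) $\pi$ is none of $(3^4,2^2)$, $(3^6)$, $(3^4,2^3)$, $(3^6,2)$, $(4,3^6)$, $(3^7,1)$, $(3^8)$, $(n-1,3^5,1^{n-6})$, $(n-1,3^6,1^{n-7})$.
   Context: All graphs are finite and simple. A non-increasing sequence of nonnegative integers is graphic if it is the degree sequence of some simple graph (a realization). For a graph $H$, a graphic sequence $\pi$ is potentially $H$-graphic if some realization of $\pi$ contains $H$ as a subgraph. $A_3$ denotes $P_2\cup K_2$, the disjoint union of a path with $3$ vertices (2 edges) and a single edge, viewed as a spanning subgraph of $K_5$; $K_5-A_3$ is the graph obtained from $K_5$ by deleting these $3$ edges. In a sequence, $r^t$ denotes $t$ consecutive terms equal to $r$.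
   Formalization: Conditions (2) and (3) are applied to the positive terms of π, with n there meaning the number of positive terms; read literally the claim fails for zero-padded exceptions, e.g. π=(3^6,0), which meets (1)–(3) but is not potentially K_5−A_3-graphic. *)

(* Defs.v *)
From HB Require Import structures.
From mathcomp Require Import all_boot.

Set Implicit Arguments.
Unset Strict Implicit.
Unset Printing Implicit Defensive.

Record sgraph := SGraph {
  vertex :> finType;
  adj : rel vertex;
  adj_sym : symmetric adj;
  adj_irr : irreflexive adj
}.

Definition degree (G : sgraph) (x : G) : nat := #|[set y | adj x y]|.

Definition degree_sequence (G : sgraph) : seq nat :=
  sort geq [seq degree x | x <- enum G].

Definition realization (G : sgraph) (s : seq nat) : Prop :=
  degree_sequence G = s.

(* Since [degree_sequence] is sorted, a graphic sequence is non-increasing. *)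
Definition graphic (s : seq nat) : Prop := exists G : sgraph, realization G s.

(* Not necessarily induced subgraph, up to isomorphism. *)
Definition contains_subgraph (G H : sgraph) : Prop :=
  exists2 f : H -> G, injective f & forall x y : H, adj x y -> adj (f x) (f y).

Definition potentially_graphic (H : sgraph) (s : seq nat) : Prop :=
  exists2 G : sgraph, realization G s & contains_subgraph G H.

(* The path 0 - 1 - 2 together with the edge 3 - 4. *)
Definition A3_adj : rel 'I_5 := fun x y =>
  (val x, val y) \in [:: (0, 1); (1, 0); (1, 2); (2, 1); (3, 4); (4, 3)].

Definition K5_minus_A3_adj : rel 'I_5 := fun x y => (x != y) && ~~ A3_adj x y.

Lemma K5_minus_A3_sym : symmetric K5_minus_A3_adj.
Proof. by do 2![case=> [[|[|[|[|[|?]]]]] ?] //]. Qed.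

Lemma K5_minus_A3_irr : irreflexive K5_minus_A3_adj.
Proof. by move=> x; rewrite /K5_minus_A3_adj eqxx. Qed.

Definition K5_minus_A3 : sgraph := SGraph K5_minus_A3_sym K5_minus_A3_irr.

(* A zero term is an isolated vertex, which never takes part in a copy of a
   graph without isolated vertices.  Comparisons with explicitly listed
   sequences therefore disregard zero terms: (3^6) is not potentially
   K_5 - A_3-graphic, and neither is (3^6, 0). *)
Definition positive_terms (s : seq nat) : seq nat := [seq x <- s | 0 < x].

Lemma positive_terms_id (s : seq nat) :
  all (leq 1) s -> positive_terms s = s.
Proof. by move=> /all_filterP. Qed.

Lemma positive_terms_zeros (s : seq nat) (m : nat) :
  positive_terms (s ++ nseq m 0) = positive_terms s.
Proof.
rewrite /positive_terms filter_cat; suff -> : [seq x <- nseq m 0 | 0 < x] = [::].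
  by rewrite cats0.
by elim: m.
Qed.

(* Main.v *)
Require Import Defs.
From HB Require Import structures.
From mathcomp Require Import all_boot zify.

(* K_5 - A_3 is K_4 with one edge subdivided.

   Sufficiency is by induction on the length: by Havel and Hakimi, deleting the
   smallest term k and lowering the k largest other terms by one preserves
   graphicality, and adding the vertex back preserves a copy of K_5 - A_3.  The
   induction only stops when the shorter sequence has fewer than four terms at
   least 3, or is exceptional.  The sequences where it stops are finitely many,
   realized by explicit graphs, up to infinite families obtained from small
   graphs by adding paths, disjoint triangles and K_2's, or triangles through the vertex of
   largest degree.

   Necessity: let W be the complement of a copy.  A vertex w of W sends at least
   deg w - (|W| - 1) edges to the copy, and the copy sends at most its degree sum
   minus 14 edges to W; this excludes the sporadic sequences.  If some vertex is
   adjacent to all others, and those have degree at most 3, then that vertex is an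
   end of the edge of K_4 opposite to the subdivided one, and the other four
   vertices of the copy have degree 3 and no neighbours outside the copy.  Hence
   besides them there are either no vertices of degree 3 or, when all degrees are
   3 or 1, at least three. *)

Set Implicit Arguments.
Unset Strict Implicit.
Unset Printing Implicit Defensive.

(** * Graphs and their degree lists *)

Notation K := K5_minus_A3.

Definition degrees (G : sgraph) : seq nat := [seq degree x | x <- enum G].

Definition realizable (s : seq nat) : Prop :=
  exists G : sgraph, perm_eq (degrees G) s.

Definition K_realizable (s : seq nat) : Prop :=
  exists2 G : sgraph, perm_eq (degrees G) s & contains_subgraph G K.

Lemma geq_total : total geq.
Proof. by move=> x y; exact: leq_total. Qed.

Lemma geq_trans : transitive geq.
Proof. by move=> y x z /= h1 h2; exact: leq_trans h2 h1. Qed.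

Lemma geq_anti : antisymmetric geq.
Proof. by move=> x y /= ; rewrite andbC => /anti_leq. Qed.

Lemma realizationP (G : sgraph) (s : seq nat) : sorted geq s ->
  realization G s <-> perm_eq (degrees G) s.
Proof.
move=> ss; split=> [<-|h]; first by rewrite perm_sym perm_sort.
apply: (sorted_eq geq_trans geq_anti) => //.
  exact: sort_sorted geq_total _.
by rewrite perm_sort.
Qed.

Lemma K_realizable_perm (s t : seq nat) : perm_eq s t ->
  K_realizable s -> K_realizable t.
Proof. by move=> st [G gs gK]; exists G => //; exact: perm_trans gs st. Qed.

Lemma realizable_perm (s t : seq nat) : perm_eq s t ->
  realizable s -> realizable t.
Proof. by move=> st [G gs]; exists G => //; exact: perm_trans gs st. Qed.

(** A permutation of the degree list lifts to an enumeration of the vertices, so that a prefix of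
    [s] becomes a set of vertices. *)
Lemma degrees_enum (G : sgraph) (s : seq nat) : perm_eq (degrees G) s ->
  exists2 vs : seq G, perm_eq (enum G) vs & [seq degree x | x <- vs] = s.
Proof.
case: (pickP (@predT G)) => [x0 _|G0].
  rewrite perm_sym => /(perm_iotaP 0) [Is hI ->].
  exists [seq nth x0 (enum G) i | i <- Is].
    rewrite -[X in perm_eq X](@mkseq_nth _ x0) /mkseq perm_map //.
    by rewrite perm_sym; move: hI; rewrite size_map.
  rewrite -map_comp; apply/eq_in_map => i; rewrite (perm_mem hI) mem_iota add0n size_map /= => hi.
  by rewrite /degrees (nth_map x0).
have e0 : enum G = [::] by apply: size0nil; rewrite -cardE (eq_card0 G0).
by rewrite /degrees e0 perm_sym => /perm_nilP ->; exists [::].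
Qed.

(** * Adding a vertex with a prescribed neighbourhood *)

Lemma some_inj (T : Type) : injective (@Some T).
Proof. by move=> x y []. Qed.

Definition add_vertex_adj (G : sgraph) (S : {set G}) : rel (option G) :=
  fun a b => match a, b with
  | Some x, Some y => adj x y
  | Some x, None | None, Some x => x \in S
  | None, None => false
  end.

Lemma add_vertex_sym (G : sgraph) (S : {set G}) : symmetric (add_vertex_adj S).
Proof. by move=> [x|] [y|] //=; exact: adj_sym. Qed.

Lemma add_vertex_irr (G : sgraph) (S : {set G}) : irreflexive (add_vertex_adj S).
Proof. by move=> [x|] //=; exact: adj_irr. Qed.

Definition add_vertex (G : sgraph) (S : {set G}) : sgraph :=
  SGraph (add_vertex_sym S) (add_vertex_irr S).

Lemma degree_add_None (G : sgraph) (S : {set G}) :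
  @degree (add_vertex S) None = #|S|.
Proof.
rewrite /degree -(card_imset _ (@some_inj G)); apply: eq_card => -[y|]; rewrite !inE /=.
  by rewrite mem_imset //; exact: some_inj.
by symmetry; apply/negbTE/imsetP; case.
Qed.

Lemma degree_add_Some (G : sgraph) (S : {set G}) (x : G) :
  @degree (add_vertex S) (Some x) = degree x + (x \in S).
Proof.
rewrite /degree (cardsD1 None) inE /= addnC; congr (_ + _).
rewrite -(card_imset _ (@some_inj G)); apply: eq_card => -[y|]; rewrite !inE /=.
  by rewrite mem_imset ?inE //; exact: some_inj.
by symmetry; apply/negbTE/imsetP; case.
Qed.

Lemma degrees_add (G : sgraph) (S : {set G}) :
  degrees (add_vertex S) =
  #|S| :: [seq degree x + (x \in S) | x <- enum G].
Proof.
rewrite /degrees enumT unlock /= degree_add_None -map_comp; congr (_ :: _).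
by rewrite enumT; apply: eq_map => x /=; rewrite degree_add_Some.
Qed.

Lemma map_take_drop (T : eqType) (f g h : T -> nat) (k : nat) (s : seq T) :
  {in take k s, h =1 f} -> {in drop k s, h =1 g} ->
  [seq h x | x <- s] = map f (take k s) ++ map g (drop k s).
Proof.
move=> hf hg; rewrite -{1}(cat_take_drop k s) map_cat.
by congr (_ ++ _); apply/eq_in_map.
Qed.

Lemma mem_drop_uniq (T : eqType) (s : seq T) k x : uniq s -> x \in drop k s ->
  (x \in take k s) = false.
Proof.
move=> us xd; apply/negbTE/negP => xt; move: us.
rewrite -{1}(cat_take_drop k s) cat_uniq => /and3P[_ /hasP[]]; by exists x.
Qed.

(** The converse of laying off: a new vertex is joined to the vertices of the first [k] terms, and
    the old copy stays. Up to a permutation of [s], any [k] vertices can be chosen. *)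
Lemma K_realizable_add (k : nat) (s : seq nat) : k <= size s ->
  K_realizable s -> K_realizable (k :: map S (take k s) ++ drop k s).
Proof.
move=> ks [G /degrees_enum[vs pvs es] [f finj fh]]; subst s.
move: ks; rewrite size_map => ks.
have uvs : uniq vs by rewrite -(perm_uniq pvs) enum_uniq.
pose A := [set x in take k vs].
exists (add_vertex A); last first.
  by exists (fun i => Some (f i)) => [x y [/finj]//|x y /fh].
have cA : #|A| = k by rewrite cardsE (card_uniqP _) ?take_uniq // size_takel.
rewrite degrees_add cA perm_cons.
rewrite (perm_trans (perm_map _ pvs)) //.
rewrite (@map_take_drop _ (fun x => (degree x).+1) (@degree G) _ k) //.
- by rewrite !map_take !map_drop -map_take -map_comp -map_take.
- by move=> x hx /=; rewrite inE hx addn1.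
- by move=> x hx /=; rewrite inE mem_drop_uniq // addn0.
Qed.

(** * Induced subgraphs *)

Section Induced.
Variables (G : sgraph) (P : pred G).

Definition induced_adj : rel {x : G | P x} := fun x y => adj (val x) (val y).

Lemma induced_sym : symmetric induced_adj.
Proof. by move=> x y; exact: adj_sym. Qed.

Lemma induced_irr : irreflexive induced_adj.
Proof. by move=> x; exact: adj_irr. Qed.

Definition induced : sgraph := SGraph induced_sym induced_irr.

Lemma degree_induced (x : induced) :
  degree x = #|[set y : G | P y & adj (val x) y]|.
Proof.
rewrite /degree -(card_imset _ val_inj); apply: eq_card => y; rewrite !inE.
apply/imsetP/andP => [[z]|[py axy]]; first by rewrite inE => az ->; split=> //; exact: valP.
by exists (Sub y py); rewrite ?inE.
Qed.

Lemma degrees_induced (vs : seq G) : perm_eq (enum G) vs ->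
  perm_eq (degrees induced)
    [seq #|[set y : G | P y & adj x y]| | x <- vs & P x].
Proof.
move=> pvs; rewrite /degrees.
rewrite (@eq_map _ _ _ ((fun x => #|[set y : G | P y & adj x y]|) \o val)); last first.
  exact: degree_induced.
rewrite map_comp; apply: perm_map; apply: uniq_perm.
- by rewrite map_inj_uniq ?enum_uniq //; exact: val_inj.
- by rewrite filter_uniq // -(perm_uniq pvs) enum_uniq.
move=> x; rewrite mem_filter -(perm_mem pvs) mem_enum andbT.
apply/mapP/idP => [[z _ ->]|px]; first exact: valP.
by exists (Sub x px); rewrite ?mem_enum.
Qed.
End Induced.

(** * Edge switching and the theorem of Havel and Hakimi *)

Section Switch.
Variable T : finType.
Implicit Types (e : rel T) (A B : {set T}).

Lemma eq_card_swap A B p q : p \in A -> q \notin A -> p \notin B -> q \in B ->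
  (forall b, b != p -> b != q -> (b \in A) = (b \in B)) -> #|A| = #|B|.
Proof.
move=> pA qA pB qB AB; rewrite (cardsD1 p A) (cardsD1 q B) pA qB.
congr (_ + _); apply: eq_card => b; rewrite !inE.
have [->|bp] := eqVneq b p; first by rewrite (negbTE pB) andbF.
have [->|bq] := eqVneq b q; first by rewrite (negbTE qA) andbF.
exact: AB.
Qed.

(** The exclusive or toggles four pairs at once: (v, y) and (x, z), which are edges wherever it is
    applied, are exchanged for (v, x) and (y, z). *)
Definition switched e (v x y z : T) : rel T := fun a b =>
  e a b (+) ((a, b) \in [:: (v, y); (y, v); (x, z); (z, x);
                            (v, x); (x, v); (y, z); (z, y)]).

Lemma switched_sym e v x y z : symmetric e -> symmetric (switched e v x y z).
Proof.
move=> es a b; rewrite /switched es; congr (_ (+) _).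
rewrite !inE !xpair_eqE.
by do 8!case: (_ == _).
Qed.

(** Each of the four vertices loses one neighbour and gains one; all other neighbourhoods are
    unchanged. *)
Lemma card_switched e v x y z a :
  symmetric e -> irreflexive e ->
  x != v -> y != v -> e v y -> ~~ e v x -> e x z -> ~~ e y z -> z != y ->
  #|[set b | switched e v x y z a b]| = #|[set b | e a b]|.
Proof.
move=> es ei xv yv evy evx exz eyz zy.
have xy : x != y by apply: contraNneq evx => ->.
have zx : z != x by apply: contraTneq exz => ->; rewrite ei.
have zv : z != v by apply: contraTneq exz => ->; rewrite es.
have E : ((x == v) = false) * ((v == x) = false) * ((y == v) = false) *
  ((v == y) = false) * ((z == v) = false) * ((v == z) = false) *
  ((x == y) = false) * ((y == x) = false) * ((x == z) = false) *
  ((z == x) = false) * ((z == y) = false) * ((y == z) = false).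
  by rewrite ![v == _]eq_sym ![_ == x]eq_sym ![y == z]eq_sym [x == z]eq_sym
    [x == v]eq_sym; do !split; apply/negbTE; rewrite // eq_sym.
have swap p q : switched e v x y z a p -> ~~ switched e v x y z a q ->
    ~~ e a p -> e a q ->
    (forall b, b != p -> b != q -> switched e v x y z a b = e a b) ->
    #|[set b | switched e v x y z a b]| = #|[set b | e a b]|.
  move=> h1 h2 h3 h4 h5; apply: (@eq_card_swap _ _ p q); rewrite ?inE //.
  by move=> b bp bq; rewrite !inE h5.
have [av|av] := eqVneq a v; first subst a.
  apply: (swap x y) => // [||b bp bq];
    by rewrite /switched ?inE ?xpair_eqE ?eqxx ?E ?(negbTE evx) ?evy ?(negbTE bp)
      ?(negbTE bq) /= ?addbF.
have [ax|ax] := eqVneq a x; first subst a.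
  apply: (swap v z) => // [|||b bp bq];
    by rewrite /switched ?inE ?xpair_eqE ?eqxx ?E ?[e x v]es ?(negbTE evx) ?exz ?(negbTE bp)
      ?(negbTE bq) /= ?addbF.
have [ay|ay] := eqVneq a y; first subst a.
  apply: (swap z v) => // [|||b bp bq];
    by rewrite /switched ?inE ?xpair_eqE ?eqxx ?E ?[e y v]es ?(negbTE eyz) ?evy ?(negbTE bp)
      ?(negbTE bq) /= ?addbF.
have [az|az] := eqVneq a z; first subst a.
  apply: (swap y x) => // [||||b bp bq];
    by rewrite /switched ?inE ?xpair_eqE ?eqxx ?E ?[e z _]es ?(negbTE eyz) ?exz ?(negbTE bp)
      ?(negbTE bq) /= ?addbF.
apply: eq_card => b; rewrite !inE /switched !inE !xpair_eqE.
by rewrite (negbTE av) (negbTE ax) (negbTE ay) (negbTE az) /= addbF.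
Qed.

(* Each switch moves one more neighbour of [v] into [S]. *)
Lemma concentrate_nbh (f : T -> nat) (v : T) (S : {set T}) e :
  symmetric e -> irreflexive e -> (forall x, #|[set y | e x y]| = f x) ->
  v \notin S -> #|S| = f v ->
  (forall x y, x \in S -> y \notin S -> y != v -> f y <= f x) ->
  exists e' : rel T, [/\ symmetric e', irreflexive e',
    forall x, #|[set y | e' x y]| = f x & forall y, e' v y = (y \in S)].
Proof.
move=> es ei ef vS cS fS.
have [n] := ubnP #|S :\: [set y | e v y]|.
elim: n e es ei ef => // n IH e es ei ef; rewrite ltnS => hn.
have [/eqP h0|[x]] := set_0Vmem (S :\: [set y | e v y]).
  exists e; split=> // y.
  have /eqP -> : S == [set y | e v y].
    by rewrite eqEcard cS ef leqnn andbT -setD_eq0.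
  by rewrite inE.
rewrite !inE => /andP[evx xS].
(* Since [S] has as many elements as [v] has neighbours, a vertex of [S] not adjacent to [v] is
   matched by a neighbour of [v] outside [S]. *)
have /set0Pn[y] : [set y | e v y] :\: S != set0.
  rewrite -card_gt0.
  have h := cardsID S [set y | e v y]; have h' := cardsID [set y | e v y] S.
  have : 0 < #|S :\: [set y | e v y]| by apply/card_gt0P; exists x; rewrite !inE evx.
  move: h h'; rewrite ef cS setIC; lia.
rewrite !inE => /andP[yS evy].
have xv : x != v by apply: contraTneq xS => ->.
have yv : y != v by apply: contraTneq evy => ->; rewrite ei.
(* Without such a [z], every neighbour of [x] except [y] would be a neighbour of [y]; as [v] is
   adjacent to [y] and not to [x], the degree of [x] would be the smaller one, against [fS]. *)
have [z] : exists z, z \in ([set b | e x b] :\ y) :\: ([set b | e y b] :\ x).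
  apply/set0Pn; apply: contraTneq (fS x y xS yS yv) => /eqP; rewrite setD_eq0 => sub.
  have vin : v \in ([set b | e y b] :\ x) by rewrite !inE eq_sym xv es.
  have := cardsD1 y [set b | e x b]; have := cardsD1 x [set b | e y b].
  have : #|[set b | e x b] :\ y| < #|[set b | e y b] :\ x|.
    apply: proper_card; apply/properP; split=> //; exists v => //.
    by rewrite !inE es (negbTE evx) andbF.
  rewrite !inE !ef [e y x]es; lia.
rewrite !inE => /and3P[hz zy exz].
have zx : z != x by apply: contraTneq exz => ->; rewrite ei.
have eyz : ~~ e y z by move: hz; rewrite zx.
have ss := @switched_sym e v x y z es.
have E w : switched e v x y z v w = (if w == x then true else if w == y then false else e v w).
  rewrite /switched !inE !xpair_eqE eqxx ![v == _]eq_sym (negbTE xv) (negbTE yv) /=.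
  have -> : (z == v) = false by apply: contraTF exz => /eqP ->; rewrite es.
  rewrite /= !orbF.
  have [->|wx] := eqVneq w x; first by rewrite (negbTE evx) orbT.
  by have [->|wy] := eqVneq w y; rewrite ?evy ?addbF.
apply: (IH (switched e v x y z)) => //.
- move=> a; rewrite /switched ei !inE !xpair_eqE /=.
  have N p q : (p != q) || (q != p) -> (a == p) && (a == q) = false.
    by rewrite [q == p]eq_sym orbb => pq; apply: contraNF pq => /andP[/eqP <- /eqP <-].
  by rewrite !N // ?xv ?yv ?zx ?zy ?orbT.
- by move=> a; rewrite card_switched.
- rewrite (cardsD1 x) !inE xS evx /= in hn.
  apply: leq_ltn_trans hn; rewrite subset_leq_card //.
  apply/subsetP => w; rewrite !inE E.
  case: eqVneq => //= wx; case: eqVneq => // -> .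
  by rewrite (negbTE yS) andbF.
Qed.
End Switch.

Lemma degree_lt (G : sgraph) (x : G) : degree x < #|G|.
Proof.
rewrite /degree [X in _ < X](cardD1 x) !inE /= add1n ltnS subset_leq_card //.
apply/subsetP => y; rewrite !inE => a; rewrite andbT.
by apply: contraTneq a => ->; rewrite adj_irr.
Qed.

Lemma realizable_lt (s : seq nat) x : realizable s -> x \in s -> x < size s.
Proof.
move=> [G gs]; rewrite -(perm_size gs) -(perm_mem gs) size_map -cardE.
by move=> /mapP[y _ ->]; exact: degree_lt.
Qed.

(** Switching makes the neighbours of the last vertex [v] exactly the first [k] vertices of [us],
    which have the largest degrees; then [v] is deleted. *)
Lemma realizable_lay_off (k : nat) (t : seq nat) : sorted geq t ->
  realizable (rcons t k) -> realizable (map predn (take k t) ++ drop k t).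
Proof.
move=> st rt.
have kt : k <= size t.
  by have := @realizable_lt _ k rt; rewrite mem_rcons inE eqxx size_rcons ltnS; exact.
case: rt => G /degrees_enum[vs].
case/lastP: vs => [|us v] pvs; first by case: t {st kt}.
rewrite map_rcons => /eqP; rewrite eqseq_rcons => /andP[/eqP tE /eqP kE].
have uvs : uniq (rcons us v) by rewrite -(perm_uniq pvs) enum_uniq.
have /andP[vus uus] : (v \notin us) && uniq us by rewrite -rcons_uniq.
have mus x : x != v -> x \in us.
  by move=> xv; have := perm_mem pvs x; rewrite mem_enum inE mem_rcons inE (negbTE xv).
have sus : size us = size t by rewrite -tE size_map.
pose S := [set x in take k us].
have vS : v \notin S by rewrite inE; apply: contra vus; exact: mem_take.
have cS : #|S| = degree v.
  by rewrite cardsE (card_uniqP _) ?take_uniq // size_takel ?sus // kE.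
have dS (x y : G) : x \in S -> y \notin S -> y != v -> degree y <= degree x.
  rewrite !inE => xS yS yv.
  have yD : y \in drop k us.
    by have := mus y yv; rewrite -{1}(cat_take_drop k us) mem_cat (negbTE yS).
  move: st; rewrite -tE sorted_map -{1}(cat_take_drop k us) sorted_pairwise; last first.
    by move=> a b c /= h1 h2; exact: leq_trans h2 h1.
  by rewrite pairwise_cat => /andP[/allrelP + _]; apply.
have [e [es ei ed ev]] :=
  @concentrate_nbh G (@degree G) v S (@adj G) (@adj_sym G) (@adj_irr G) (fun=> erefl) vS cS dS.
pose G' := SGraph es ei.
pose P := [pred x : G' | x != v].
exists (induced P).
have /permPl-> := @degrees_induced G' P (rcons us v) pvs.
have -> : [seq x <- rcons us v | P x] = us.
  rewrite filter_rcons /= eqxx; apply/all_filterP/allP => x xu /=.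
  by apply: contraTneq xu => ->.
have dE x : x != v -> #|[set y : G' | P y & @adj G' x y]| = degree x - (x \in S).
  move=> xv; rewrite -ed (cardsD1 v [set y | e x y]) inE es ev addKn.
  by apply: eq_card => y; rewrite !inE.
rewrite (@map_take_drop _ (fun x => (degree x).-1) (@degree G) _ k) //.
- by rewrite -tE -map_take -map_drop -map_comp.
- move=> x xk; rewrite dE ?inE ?xk ?subn1 //.
  by apply: contraTneq (mem_take xk) => ->.
- move=> x xk; rewrite dE ?inE ?mem_drop_uniq ?subn0 //.
  by apply: contraTneq (mem_drop xk) => ->.
Qed.

Lemma sumn_map_predn (s : seq nat) : all (leq 1) s ->
  sumn (map predn s) + size s = sumn s.
Proof. by elim: s => //= x s IH /andP[x0 /IH <-]; lia. Qed.

(** * Isolated vertices *)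

Lemma filter_degrees_pos (G : sgraph) (s : seq nat) : perm_eq (degrees G) s ->
  perm_eq (degrees (induced (fun x : G => 0 < degree x))) (positive_terms s).
Proof.
move=> h; have /permPl-> := degrees_induced (fun x : G => 0 < degree x) (perm_refl (enum G)).
have /permPr <- := perm_filter (fun x => 0 < x) h.
rewrite /degrees [X in perm_eq _ X]filter_map; rewrite (@eq_map _ _ _ (@degree G)) // => x.
apply: eq_card => y; rewrite !inE andbC; case: (boolP (adj x y)) => //= a.
(* A neighbour of a vertex is never isolated, so the remaining degrees do not change. *)
by rewrite card_gt0; apply/set0Pn; exists x; rewrite inE adj_sym.
Qed.

Lemma realizable_positive (s : seq nat) :
  realizable s -> realizable (positive_terms s).
Proof. by move=> [G /filter_degrees_pos]; eexists; eassumption. Qed.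

(** Hence deleting isolated vertices does not touch a copy of [K]. *)
Lemma K_no_isolated (i : K) : exists j : K, adj i j.
Proof.
suff /existsP : [exists j : 'I_5, K5_minus_A3_adj i j] by [].
case: i => -[|[|[|[|[|//]]]]] h /=; apply/existsP;
 [exists (inord 2)|exists (inord 3)|exists (inord 3)|exists (inord 2)|exists (inord 2)];
 by rewrite /K5_minus_A3_adj /A3_adj -val_eqE /= inordK.
Qed.

Lemma K_realizable_positive (s : seq nat) :
  K_realizable s -> K_realizable (positive_terms s).
Proof.
move=> [G gs [f finj fh]]; exists (induced (fun x : G => 0 < degree x)).
  exact: filter_degrees_pos.
have pos i : 0 < degree (f i).
  have [j /fh a] := K_no_isolated i.
  by rewrite card_gt0; apply/set0Pn; exists (f j); rewrite inE.
exists (fun i => Sub (f i) (pos i)) => [i j /(congr1 val)/finj//|i j /fh].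
by rewrite /= /induced_adj.
Qed.

Lemma K_realizable_cat0 (c : nat) (s : seq nat) :
  K_realizable s -> K_realizable (nseq c 0 ++ s).
Proof.
move=> h; elim: c => //= c IH.
by have := K_realizable_add (leq0n _) IH; rewrite take0 drop0.
Qed.

Lemma K_realizable_of_positive (s : seq nat) :
  K_realizable (positive_terms s) -> K_realizable s.
Proof.
move=> /(K_realizable_cat0 (count_mem 0 s)); apply: K_realizable_perm.
have -> : nseq (count_mem 0 s) 0 = [seq x <- s | ~~ (0 < x)].
  elim: s => //= x s IH; rewrite lt0n negbK eq_sym.
  by case: eqVneq => [<-|_] //=; rewrite IH.
by rewrite perm_catC; apply/permPl/perm_filterC.
Qed.

(** * Graphs given by edge lists *)

Section EdgeList.
Variables (n : nat) (E : seq (nat * nat)).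

(** Symmetrized and without loops, so that any list of pairs gives a simple graph; stated on [nat],
    so that degrees can be computed. *)
Definition edge_rel : rel nat := fun x y =>
  (x != y) && (((x, y) \in E) || ((y, x) \in E)).

Definition edge_graph_adj : rel 'I_n := fun x y => edge_rel x y.

Lemma edge_graph_sym : symmetric edge_graph_adj.
Proof. by move=> x y; rewrite /edge_graph_adj /edge_rel eq_sym orbC. Qed.

Lemma edge_graph_irr : irreflexive edge_graph_adj.
Proof. by move=> x; rewrite /edge_graph_adj /edge_rel eqxx. Qed.

Definition edge_graph : sgraph := SGraph edge_graph_sym edge_graph_irr.

Lemma degrees_edge_graph :
  degrees edge_graph = [seq count (edge_rel i) (iota 0 n) | i <- iota 0 n].
Proof.
rewrite /degrees -val_enum_ord -map_comp; apply: eq_map => x /=.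
by rewrite count_map /degree cardsE cardE size_filter enumT; apply: eq_count => y.
Qed.
End EdgeList.

(** Vertex 1 subdivides the edge between 3 and 4 of the K_4 on 0, 2, 3, 4. *)
Definition K_edges : seq (nat * nat) :=
  [:: (0, 2); (0, 3); (0, 4); (1, 3); (1, 4); (2, 3); (2, 4)].

Lemma K_realizable_edges (n : nat) (E : seq (nat * nat)) (s : seq nat) :
  (5 <= n) && perm_eq [seq count (edge_rel (K_edges ++ E) i) (iota 0 n) | i <- iota 0 n] s ->
  K_realizable s.
Proof.
case/andP => n5 h; exists (edge_graph n (K_edges ++ E)); first by rewrite degrees_edge_graph.
exists (fun i : 'I_5 => widen_ord n5 i : edge_graph n (K_edges ++ E)).
  by move=> i j /(congr1 val) /= /val_inj.
move=> i j; rewrite /edge_graph /edge_graph_adj /edge_rel.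
move: i j; do 2![case=> [[|[|[|[|[|?]]]]] ?] //] => _;
  by rewrite /= /edge_graph_adj /edge_rel orbC.
Qed.

(** * Laying off the last term *)

Definition lay_off (k : nat) (t : seq nat) : seq nat :=
  map predn (take k t) ++ drop k t.

(** Turns a bound on a term into a count, which is invariant under permutation. For positive [a] the
    default 0 of [nth] agrees with the count beyond the end of [s]. *)
Lemma count_geq_sorted (a i : nat) (s : seq nat) : sorted geq s -> 0 < a ->
  (a <= nth 0 s i) = (i < count (leq a) s).
Proof.
move=> + a0; elim: s i => [|x s IH] [|i] //= ss; rewrite ?nth_nil; try lia.
- have := order_path_min geq_trans ss => /allP sx.
  case: (leqP a x) => [//|xa]; rewrite add0n; symmetry; apply/negbTE; rewrite -leqNgt leqn0.
  by rewrite -leqn0 leqNgt -has_count; apply/hasPn => y /sx /=; lia.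
- rewrite IH; last exact: path_sorted ss.
  have := order_path_min geq_trans ss => /allP sx.
  case: (leqP a x) => [//|xa]; rewrite add0n.
  suff -> : count (leq a) s = 0 by lia.
  by apply/eqP; rewrite -leqn0 leqNgt -has_count; apply/hasPn => y /sx /=; lia.
Qed.

Lemma sumn_lay_off (k : nat) (t : seq nat) : k <= size t -> all (leq 1) (take k t) ->
  sumn (lay_off k t) + k = sumn t.
Proof.
move=> kt /sumn_map_predn; rewrite size_takel // => h.
by rewrite -[in RHS](cat_take_drop k t) !sumn_cat -h; lia.
Qed.

Lemma sorted_rcons_geq (t : seq nat) k : sorted geq (rcons t k) ->
  sorted geq t /\ all (leq k) t.
Proof.
rewrite -cats1 sorted_pairwise ?pairwise_cat; last exact: geq_trans.
rewrite -sorted_pairwise; last exact: geq_trans.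
by case/and3P; rewrite allrelC allrel1l.
Qed.

(** By induction on the length: laying off a last term [k] lowers the total by [k] twice, once for
    the term itself and once for the lowered terms. *)
Lemma realizable_even (s : seq nat) : realizable s -> ~~ odd (sumn s).
Proof.
have [n] := ubnP (size s); elim: n s => // n IH s sn rs.
have ps : perm_eq (sort geq s) s by rewrite perm_sort.
rewrite -(perm_sumn ps); move: rs => /(realizable_perm (etrans (perm_sym _ _) ps)).
have := sort_sorted geq_total s; move: sn; rewrite -(perm_size ps).
case/lastP: (sort geq s) => [|t k] //; rewrite size_rcons => tn /sorted_rcons_geq[st kt] rt.
have hk : k <= size t.
  by have := @realizable_lt _ k rt; rewrite mem_rcons inE eqxx size_rcons ltnS; exact.
have h := IH _ _ (realizable_lay_off st rt).
have h1 : all (leq 1) (take k t).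
  case: {hk h rt} k kt => [|k] kt; first by rewrite take0.
  by apply/allP => x /mem_take/(allP kt) /=; lia.
have hs : size (lay_off k t) = size t.
  by rewrite size_cat size_map -size_cat cat_take_drop.
have := h; rewrite -/(lay_off k t) hs => /(_ tn).
by rewrite sumn_rcons -(sumn_lay_off hk h1) -addnA addnn oddD odd_double addbF.
Qed.

(** * Enlarging a realization, and the infinite realizable families *)

Ltac perm_by_count :=
  rewrite ?addn0; apply/permP => p;
  rewrite ?/= ?(count_cat, count_nseq) ?/=
    ?(count_cat, count_nseq) ?/=; nia.

(** A triangle through the first vertex: a pendant vertex is attached to it, then a further vertex
    is joined to both. *)
Lemma K_realizable_petal (x : nat) (s : seq nat) :
  K_realizable (x :: s) -> K_realizable (x.+2 :: 2 :: 2 :: s).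
Proof.
move=> h; have h1 := @K_realizable_add 1 (x :: s) isT h.
have := @K_realizable_add 2 [:: 1, x.+1 & s] isT.
rewrite /= take0 drop0 in h1 *; move/(_ h1).
by apply: K_realizable_perm; perm_by_count.
Qed.

Lemma K_realizable_K2 (s : seq nat) : K_realizable s -> K_realizable (1 :: 1 :: s).
Proof.
move=> h; have h0 := @K_realizable_add 0 s isT h.
have := @K_realizable_add 1 (0 :: s) isT.
by rewrite /= !take0 !drop0 in h0 *; apply.
Qed.

Lemma K_realizable_triangle (s : seq nat) : K_realizable s -> K_realizable [:: 2, 2, 2 & s].
Proof.
move=> /K_realizable_K2/(@K_realizable_add 2 [:: 1, 1 & s] isT).
by rewrite /= take0 drop0.
Qed.

(** The old leaf becomes an inner vertex, so a path grows by one vertex. *)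
Lemma K_realizable_pendant (s : seq nat) : K_realizable (1 :: s) -> K_realizable (1 :: 2 :: s).
Proof. by move=> /(@K_realizable_add 1 (1 :: s) isT); rewrite /= take0 drop0. Qed.

(* Each sequence is realized by [K_edges] plus the listed edges (computer search). *)
Definition witnesses : seq (seq (nat * nat) * seq nat) := [::
([::], [:: 3; 3; 3; 3; 2]);
([:: (1, 5); (5, 6)], [:: 3; 3; 3; 3; 3; 2; 1]);
([:: (0, 5); (5, 6)], [:: 4; 3; 3; 3; 2; 2; 1]);
([:: (1, 5); (1, 6); (5, 6)], [:: 4; 3; 3; 3; 3; 2; 2]);
([:: (0, 5); (1, 5); (5, 6)], [:: 4; 3; 3; 3; 3; 3; 1]);
([:: (2, 5); (3, 6); (5, 6)], [:: 4; 4; 3; 3; 2; 2; 2]);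
([:: (0, 5); (1, 5); (1, 6); (5, 6)], [:: 4; 4; 3; 3; 3; 3; 2]);
([:: (1, 5); (1, 6); (2, 5); (3, 6); (5, 6)], [:: 4; 4; 4; 3; 3; 3; 3]);
([:: (0, 1); (0, 5); (0, 6); (1, 5); (5, 6)], [:: 6; 4; 3; 3; 3; 3; 2]);
([:: (1, 5); (1, 6); (3, 4); (3, 5); (3, 6); (5, 6)], [:: 6; 4; 4; 3; 3; 3; 3]);
([:: (1, 5); (5, 6); (6, 7)], [:: 3; 3; 3; 3; 3; 2; 2; 1]);
([:: (1, 5); (5, 6); (5, 7); (6, 7)], [:: 3; 3; 3; 3; 3; 3; 2; 2]);
([:: (0, 5); (5, 6); (6, 7)], [:: 4; 3; 3; 3; 2; 2; 2; 1]);
([:: (1, 5); (1, 6); (5, 7); (6, 7)], [:: 4; 3; 3; 3; 3; 2; 2; 2]);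
([:: (1, 5); (1, 6); (5, 6); (5, 7)], [:: 4; 3; 3; 3; 3; 3; 2; 1]);
([:: (1, 5); (1, 6); (5, 6); (5, 7); (6, 7)], [:: 4; 3; 3; 3; 3; 3; 3; 2]);
([:: (2, 5); (3, 6); (5, 7); (6, 7)], [:: 4; 4; 3; 3; 2; 2; 2; 2]);
([:: (0, 1); (1, 5); (5, 6); (5, 7); (6, 7)], [:: 4; 4; 3; 3; 3; 3; 2; 2]);
([:: (0, 5); (1, 5); (1, 6); (5, 6); (6, 7)], [:: 4; 4; 3; 3; 3; 3; 3; 1]);
([:: (0, 5); (1, 6); (1, 7); (5, 6); (5, 7); (6, 7)], [:: 4; 4; 3; 3; 3; 3; 3; 3]);
([:: (1, 2); (1, 5); (3, 6); (5, 6); (5, 7); (6, 7)], [:: 4; 4; 4; 3; 3; 3; 3; 2]);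
([:: (0, 1); (1, 5); (3, 6); (4, 7); (5, 6); (5, 7); (6, 7)], [:: 4; 4; 4; 4; 3; 3; 3; 3]);
([:: (1, 5); (2, 5); (2, 6); (5, 6); (6, 7)], [:: 5; 3; 3; 3; 3; 3; 3; 1]);
([:: (0, 1); (1, 5); (1, 6); (5, 6); (5, 7); (6, 7)], [:: 5; 4; 3; 3; 3; 3; 3; 2]);
([:: (1, 2); (1, 5); (1, 6); (3, 7); (5, 6); (5, 7); (6, 7)], [:: 5; 4; 4; 3; 3; 3; 3; 3]);
([:: (0, 1); (0, 5); (0, 6); (0, 7); (1, 5); (5, 6); (6, 7)], [:: 7; 4; 3; 3; 3; 3; 3; 2]);
([:: (0, 1); (1, 2); (1, 5); (1, 6); (1, 7); (5, 6); (5, 7); (6, 7)], [:: 7; 4; 4; 3; 3; 3; 3; 3]);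
([:: (1, 5); (1, 6); (5, 6); (5, 7); (6, 8)], [:: 4; 3; 3; 3; 3; 3; 3; 1; 1]);
([:: (1, 5); (1, 6); (5, 6); (5, 7); (6, 7); (7, 8)], [:: 4; 3; 3; 3; 3; 3; 3; 3; 1]);
([:: (0, 1); (1, 5); (5, 6); (5, 7); (6, 7); (6, 8); (7, 8)], [:: 4; 4; 3; 3; 3; 3; 3; 3; 2]);
([:: (1, 2); (1, 5); (3, 6); (5, 7); (5, 8); (6, 7); (6, 8); (7, 8)],
  [:: 4; 4; 4; 3; 3; 3; 3; 3; 3]);
([:: (0, 1)], [:: 4; 3; 3; 3; 3]);
([:: (3, 4)], [:: 4; 4; 3; 3; 2]);
([:: (0, 1); (1, 2)], [:: 4; 4; 4; 3; 3]);
([:: (0, 1); (1, 2); (3, 4)], [:: 4; 4; 4; 4; 4]);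
([:: (2, 5); (2, 6); (5, 7); (6, 7)], [:: 5; 3; 3; 3; 2; 2; 2; 2]);
([:: (2, 5); (2, 6); (5, 7); (6, 8); (7, 8)], [:: 5; 3; 3; 3; 2; 2; 2; 2; 2]);
([:: (5, 6); (5, 7); (6, 8); (7, 8)], [:: 3; 3; 3; 3; 2; 2; 2; 2; 2]);
([:: (5, 6); (5, 7); (6, 8); (7, 9); (8, 9)], [:: 3; 3; 3; 3; 2; 2; 2; 2; 2; 2])
].

Lemma K_realizable_witness (s : seq nat) : s \in map snd witnesses -> K_realizable s.
Proof.
have : all (fun w => (5 <= size w.2) && perm_eq
    [seq count (edge_rel (K_edges ++ w.1) i) (iota 0 (size w.2)) | i <- iota 0 (size w.2)] w.2)
    witnesses by vm_compute.
by move=> /allP h /mapP[w /h hw ->]; exact: K_realizable_edges hw.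
Qed.

(** The copy uses one term 2, and the other [b - 1] vertices form disjoint cycles, which is possible
    unless [b - 1] is 1 or 2. The copy alone, and the copy with a 4-cycle or a 5-cycle, are
    explicit; triangles do the rest. *)
Lemma K_realizable_3_2 (b : nat) : b <> 0 -> b <> 2 -> b <> 3 ->
  K_realizable (nseq 4 3 ++ nseq b 2).
Proof.
have [n] := ubnP b; elim: n b => // n IH [|[|[|[|b]]]] // bn _ _ _.
  exact: K_realizable_witness.
have [b1|[b2|h]] : b = 1 \/ b = 2 \/ (b <> 1 /\ b <> 2) by lia.
- by subst b; exact: K_realizable_witness.
- by subst b; exact: K_realizable_witness.
have := K_realizable_triangle (IH b.+1 ltac:(lia) ltac:(lia) ltac:(lia) ltac:(lia)).
by apply: K_realizable_perm; perm_by_count.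
Qed.

(** Outside the copy, two terms 1 and the remaining terms 2 form a path, and the other terms 1 are
    paired into K_2's. *)
Lemma K_realizable_3_2_1 (a b : nat) : 1 <= a -> 2 <= b -> ~~ odd b ->
  K_realizable (nseq 4 3 ++ nseq a 2 ++ nseq b 1).
Proof.
move=> a1 b2 eb; have {a1} -> : a = a.-1.+1 by lia.
have -> : b = (b./2.-1).*2.+2 by lia.
elim: (b./2.-1) {b2 eb} => [|c IH]; last first.
  by have := K_realizable_K2 IH; apply: K_realizable_perm; perm_by_count.
elim: a.-1 => [|e /= IH].
  apply: (@K_realizable_perm [:: 1, 1 & nseq 4 3 ++ nseq 1 2]); first by perm_by_count.
  exact/K_realizable_K2/K_realizable_3_2.
apply: (@K_realizable_perm [:: 1, 2, 1 & nseq 4 3 ++ nseq e.+1 2]); first by perm_by_count.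
apply: K_realizable_pendant; move: IH; apply: K_realizable_perm; perm_by_count.
Qed.

Lemma K_realizable_petals (x c : nat) (s : seq nat) :
  K_realizable (x :: s) -> K_realizable (c.*2 + x :: nseq c.*2 2 ++ s).
Proof. by move=> h; elim: c => //= c IH; exact: K_realizable_petal. Qed.

(** Triangles through a vertex of degree 3 in the copy raise its degree to [x] and leave [c] terms
    2. If [c] is 2 or 3, [K_realizable_3_2] does not apply, and the triangles are added to an
    explicit graph whose largest degree is 5. *)
Lemma K_realizable_star (x b : nat) : odd x -> 3 <= x -> x < b + 3 ->
  (x = 3 -> b <> 2 /\ b <> 3) -> K_realizable (x :: nseq 3 3 ++ nseq b 2).
Proof.
move=> ox x3 xb h.
have [x0|x5] : x = 3 \/ 5 <= x by lia.
  by subst x; apply: (@K_realizable_3_2 b); lia.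
pose c := b + 3 - x.
have [hc|hc] : (c = 2 \/ c = 3) \/ (c <> 2 /\ c <> 3) by lia.
  have h5 : K_realizable (5 :: nseq 3 3 ++ nseq c.+2 2).
    by case: hc => ->; exact: K_realizable_witness.
  have := @K_realizable_petals 5 (x - 5)./2 _ h5.
  have -> : (x - 5)./2.*2 + 5 = x by lia.
  have -> : b = (x - 5)./2.*2 + c.+2 by lia.
  by apply: K_realizable_perm; perm_by_count.
have h3 : K_realizable (3 :: nseq 3 3 ++ nseq c 2) by apply: K_realizable_3_2; lia.
have := @K_realizable_petals 3 (x - 3)./2 _ h3.
have -> : (x - 3)./2.*2 + 3 = x by lia.
have -> : b = (x - 3)./2.*2 + c by lia.
by apply: K_realizable_perm; perm_by_count.
Qed.

(** * The exceptional sequences *)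

Definition sporadic : seq (seq nat) :=
  [:: nseq 4 3 ++ nseq 2 2; nseq 6 3; nseq 4 3 ++ nseq 3 2; nseq 6 3 ++ nseq 1 2;
      4 :: nseq 6 3; nseq 7 3 ++ nseq 1 1; nseq 8 3].

(* [star2 (n - k) (k - 4)] is the sequence (n-1, 3^3, 2^(n-k), 1^(k-4)). *)
Definition star2 (a b : nat) : seq nat :=
  3 + a + b :: nseq 3 3 ++ nseq a 2 ++ nseq b 1.

Definition star3 (c b : nat) : seq nat := c + b :: nseq c 3 ++ nseq b 1.

(** Boolean, so that finitely many cases can be settled by evaluation. A truncated [m - 6] or
    [m - 7] does no harm, as the sizes then differ. *)
Definition exceptional (s : seq nat) : bool :=
  let m := size s in
  [|| s \in sporadic, s == star3 5 (m - 6), s == star3 6 (m - 7) |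
      has (fun a => [&& 2 <= a, ~~ odd a & s == star2 a (m - 4 - a)]) (iota 0 m)].

Lemma size_star2 a b : size (star2 a b) = 4 + a + b.
Proof. by rewrite /= size_cat !size_nseq; lia. Qed.

Lemma size_star3 c b : size (star3 c b) = c.+1 + b.
Proof. by rewrite /= size_cat !size_nseq. Qed.

Lemma exceptional_star2 a b : 2 <= a -> ~~ odd a -> exceptional (star2 a b).
Proof.
move=> a2 ea; apply/or4P/Or44/hasP; exists a; first by rewrite mem_iota size_star2; lia.
rewrite a2 ea size_star2 /=.
by have -> : 4 + a + b - 4 - a = b by lia.
Qed.

Lemma exceptional_star3 c b : c \in [:: 5; 6] -> exceptional (star3 c b).
Proof.
rewrite /exceptional size_star3 !inE => /orP[] /eqP ->.
  by rewrite addKn eqxx orbT.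
by rewrite addKn eqxx !orbT.
Qed.

Lemma exceptionalP (s : seq nat) : exceptional s ->
  [\/ s \in sporadic, exists b, s = star3 5 b, exists b, s = star3 6 b |
      exists a b, [/\ 2 <= a, ~~ odd a & s = star2 a b]].
Proof.
case/or4P => [h|/eqP h|/eqP h|/hasP[a _ /and3P[a2 ea /eqP h]]].
- exact: Or41.
- by apply: Or42; eexists; exact: h.
- by apply: Or43; eexists; exact: h.
- by apply: Or44; exists a, (size s - 4 - a).
Qed.

Lemma sorted_geq_nseq_cat (n x : nat) (s : seq nat) :
  sorted geq s -> all (geq x) s -> sorted geq (nseq n x ++ s).
Proof.
move=> ss xs; elim: n => //= n IH.
rewrite path_sortedE; last exact: geq_trans.
by rewrite IH all_cat xs all_nseq /= leqnn orbT.
Qed.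

Lemma sorted_blocks (a b c : nat) : sorted geq (nseq a 3 ++ nseq b 2 ++ nseq c 1).
Proof.
apply: sorted_geq_nseq_cat; last by rewrite all_cat !all_nseq /= !orbT.
apply: sorted_geq_nseq_cat; last by rewrite all_nseq orbT.
by rewrite -[nseq c 1]cats0; exact: sorted_geq_nseq_cat.
Qed.

Lemma perm_blocks (a b c : nat) (s : seq nat) : sorted geq s ->
  perm_eq s (nseq a 3 ++ nseq b 2 ++ nseq c 1) -> s = nseq a 3 ++ nseq b 2 ++ nseq c 1.
Proof.
by move=> ss; apply: (sorted_eq geq_trans geq_anti) => //; exact: sorted_blocks.
Qed.

Lemma le3_blocks (s : seq nat) : sorted geq s -> all (fun x => 1 <= x <= 3) s ->
  s = nseq (count_mem 3 s) 3 ++ nseq (count_mem 2 s) 2 ++ nseq (count_mem 1 s) 1.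
Proof.
move=> ss h; apply: perm_blocks => //.
elim: s {ss} h => //= x s IH /andP[hx /IH h].
have /permP {}h := h; apply/permP => p; rewrite /= h !count_cat !count_nseq.
have [->|[->|->]] : x = 1 \/ x = 2 \/ x = 3 by lia.
all: rewrite /=; lia.
Qed.

(** * Sequences that become exceptional by laying off *)

(* An entry [M >= 5] above entries at most 3 can only come from the first term:
   laying off lowers the largest term by one. *)
Lemma perm_head_large (h M : nat) (r E : seq nat) : 5 <= M -> all (geq 3) E ->
  all (geq h.+1) r -> perm_eq (h :: r) (M :: E) -> h = M /\ perm_eq r E.
Proof.
move=> M5 /allP E3 /allP rh hp.
have hM : h = M.
  have : M \in h :: r by rewrite (perm_mem hp) mem_head.
  rewrite inE => /orP[/eqP //|/rh /= Mh].
  have : h \in M :: E by rewrite -(perm_mem hp) mem_head.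
  by rewrite inE => /orP[/eqP //|/E3 /=]; lia.
by split=> //; move: hp; rewrite hM perm_cons.
Qed.

Definition finite_exceptions : seq (seq nat) :=
  sporadic ++ [:: star3 5 0; star3 6 0].

(** Laying off is undone in all possible ways: every order [u] of an exception, every [k], with the
    first [k] terms raised; only non-increasing results matter. *)
Lemma lay_off_cases : all (fun E => all (fun u => all (fun k =>
    let s := rcons (map S (take k u) ++ drop k u) k in
    sorted geq s ==> exceptional s || (s \in map snd witnesses))
  (iota 1 (size E))) (permutations E)) finite_exceptions.
Proof. by vm_compute. Qed.

Lemma lay_offK (k : nat) (t : seq nat) : k <= size t -> all (leq 1) (take k t) ->
  map S (take k (lay_off k t)) ++ drop k (lay_off k t) = t.
Proof.
move=> kt /allP h.
have hk : size (map predn (take k t)) = k by rewrite size_map size_takel.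
rewrite /lay_off take_cat drop_cat hk ltnn subnn take0 drop0 cats0 -map_comp.
rewrite -[RHS](cat_take_drop k t); congr (_ ++ _).
by rewrite -[RHS]map_id; apply/eq_in_map => x /h /=; lia.
Qed.

Lemma finite_exception_lay_off (k : nat) (t E : seq nat) : E \in finite_exceptions ->
  1 <= k <= size t -> sorted geq (rcons t k) -> all (leq 1) (take k t) ->
  perm_eq (lay_off k t) E -> exceptional (rcons t k) \/ K_realizable (rcons t k).
Proof.
move=> /(allP lay_off_cases) h /andP[k1 kt] st at1 pE.
have := allP h (lay_off k t); rewrite mem_permutations => /(_ pE) /allP /(_ k).
rewrite mem_iota -(perm_size pE) size_cat size_map -size_cat cat_take_drop k1 add1n ltnS kt.
rewrite lay_offK // => /(_ isT) /implyP /(_ st) /orP[]; first by left.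
by move=> /K_realizable_witness; right.
Qed.

Lemma all_geq_nth (s : seq nat) (i j : nat) : sorted geq s -> i <= j -> j < size s ->
  nth 0 s j <= nth 0 s i.
Proof.
move=> ss ij js.
by apply: (sorted_leq_nth geq_trans leqnn 0 ss) => //; rewrite inE (leq_ltn_trans ij).
Qed.

(** For [k = 2] only the first two terms are lowered, and they are at least 3; for larger [k] every
    term is at least 3. *)
Lemma lay_off_ge2 (k : nat) (t : seq nat) : 2 <= k -> all (leq k) t -> sorted geq t ->
  3 <= nth 0 t 3 -> all (leq 2) (lay_off k t).
Proof.
move=> k2 kt st t3; rewrite /lay_off all_cat all_map; apply/andP; split; last first.
  by apply/allP => x /mem_drop/(allP kt) /=; exact: leq_trans.
have [k2'|k3] : k = 2 \/ 3 <= k by lia.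
  subst k; case: t st t3 {kt} => [|a [|b [|c [|d t]]]] //= /and4P[h1 h2 h3 _] h4.
  by rewrite andbT /=; lia.
by apply/allP => x /mem_take/(allP kt) /=; lia.
Qed.

Lemma sorted_consE (a : nat) (s : seq nat) :
  sorted geq (a :: s) = all (geq a) s && sorted geq s.
Proof. by rewrite /= path_sortedE //; exact: geq_trans. Qed.

Lemma nth_le_all (a i : nat) (s : seq nat) : all (geq a) s -> nth 0 s i <= a.
Proof.
move=> /allP h; case: (ltnP i (size s)) => [/(mem_nth 0)/h //|hi].
by rewrite nth_default.
Qed.

(** The large first term of [star2] must come from the first term of [t], which gives [t1]; the rest
    depends on the last term. *)
Lemma lay_off_star2 (k a b : nat) (t : seq nat) :
  2 <= a -> ~~ odd a -> 1 <= k -> sorted geq (rcons t k) ->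
  3 <= nth 0 t 3 -> perm_eq (lay_off k t) (star2 a b) ->
  exceptional (rcons t k) \/ K_realizable (rcons t k).
Proof.
move=> a2 ea k1 /sorted_rcons_geq[st kt] t3.
case: k k1 kt => // k _; case: t st t3 => [|t1 t] //; rewrite sorted_consE /= => /andP[t1t st] t3.
move=> /andP[kt1 kt].
rewrite /lay_off /= /star2.
move=> /perm_head_large[].
- lia.
- by rewrite /= all_cat !all_nseq /= !orbT.
- have -> : t1.-1.+1 = t1.
    by have := nth_le_all 2 t1t; lia.
  rewrite all_cat all_map; apply/andP; split; apply/allP => x.
    by move=> /mem_take/(allP t1t) /=; lia.
  by move=> /mem_drop/(allP t1t).
move=> t1E pt.
have {t1E} -> : t1 = 4 + a + b by lia.
(* Last term 1: the family is continued with one more term 1. *)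
case: k kt pt {kt1} => [|k] kt.
  rewrite take0 drop0 /= => pt.
  have {pt} -> := @perm_blocks 3 a b _ st pt.
  left; have := exceptional_star2 b.+1 a2 ea; congr (is_true (exceptional _)).
  rewrite /star2 /= rcons_cat; congr [:: _, 3, 3, 3 & _ ++ _]; first lia.
  by elim: (b) => //= n ->.
case: t st t1t kt t3 => [|t2 t] //; rewrite sorted_consE.
move=> /andP[t2t st] /andP[t12 _] /= /andP[kt2 kt] t3.
(* The last term is now at least 2, so no term 1 can arise. *)
case: b => [|b]; last first.
  move=> pt; have : 1 \in t2.-1 :: map predn (take k t) ++ drop k t.
    by rewrite (perm_mem pt) !inE ?mem_cat ?mem_nseq ?eqxx ?orbT.
  have t23 : 3 <= t2 by have := nth_le_all 1 t2t; lia.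
  rewrite inE mem_cat => /or3P[|/mapP[x xt]|/mem_drop/(allP kt)//]; first by lia.
  case: k xt kt {kt2 pt} => [|k] xt kt; first by rewrite take0 in xt.
  by have := allP kt x (mem_take xt) => /=; lia.
rewrite addn0 cats0.
(* Last term 2: the second term is 4 or 3, and [a./2] triangles are attached to a vertex of degree 4
   in a graph on five vertices. *)
case: k kt kt2 => [|k] kt kt2.
  rewrite take0 drop0 /= => pt; right.
  have t2in : t2.-1 \in nseq 3 3 ++ nseq a 2 by rewrite -(perm_mem pt) mem_head.
  have [h|h] : t2 = 4 \/ t2 = 3 by move: t2in; rewrite mem_cat !mem_nseq; lia.
    subst t2; move: pt; rewrite perm_cons -[nseq a 2]cats0 => pt.
    have {pt} -> := @perm_blocks 2 a 0 _ st pt.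
    have := @K_realizable_petals 4 a./2 [:: 4; 3; 3; 2].
    have -> : a./2.*2 = a by lia.
  rewrite [a + 4]addnC.
    move=> /(_ (@K_realizable_witness [:: 4; 4; 3; 3; 2] isT)).
    by apply: K_realizable_perm; rewrite -cats1; perm_by_count.
  subst t2.
  have {}pt : perm_eq t (nseq 3 3 ++ nseq a.-1 2 ++ nseq 0 1).
    rewrite -(perm_cons 2); apply: perm_trans pt _.
    by case: a a2 {ea t2in} => // a _; perm_by_count.
  have {pt} -> := @perm_blocks 3 a.-1 0 _ st pt.
  have := @K_realizable_petals 4 a./2 (nseq 4 3).
  have -> : a./2.*2 = a by lia.
  rewrite [a + 4]addnC.
  move=> /(_ (@K_realizable_witness [:: 4; 3; 3; 3; 3] isT)).
  apply: K_realizable_perm; rewrite -cats1.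
  by case: a a2 {ea t2in} => // a _; perm_by_count.
(* Last term at least 4: every term stays at least 3, but [star2] contains a 2. *)
case: k kt kt2 => [|k] kt kt2; last first.
  move=> pt; have : 2 \in t2.-1 :: map predn (take k.+2 t) ++ drop k.+2 t.
    by rewrite (perm_mem pt) ?inE ?mem_cat ?mem_nseq; lia.
  rewrite inE mem_cat => /or3P[|/mapP[x /mem_take/(allP kt) /=]|/mem_drop/(allP kt)] /=; lia.
case: t t2t st kt t3 => [|t4 t] //=.
rewrite take0 drop0 => /andP[t42 t2t] st /andP[kt4 kt] t3 pt.
(* Last term 3: a 2 arises only by lowering a 3 in the second or third place, so [a = 2] and the
   sequence is [star3 6 0]. *)
have c2 : a <= (t2 == 3) + (t4 == 3).
  have /permP/(_ (pred1 2)) := pt; rewrite /= ?count_cat !count_nseq /= => h.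
  have : count_mem 2 t = 0 by apply/count_memPn/negP => /(allP kt).
  move=> h0; move: h; rewrite h0 !add0n mul1n addn0 => <-; do 4!case: eqP => ?; lia.
have [a_2 t2_3 t4_3] : [/\ a = 2, t2 = 3 & t4 = 3].
  by move: c2; do 2!case: eqP => ?; split; lia.
subst a t2 t4; left; suff -> : t = nseq 3 3 by [].
rewrite (_ : nseq 3 3 = nseq 3 3 ++ nseq 0 2 ++ nseq 0 1) //.
apply: perm_blocks; first by exact: path_sorted st.
rewrite -(perm_cons 2) -(perm_cons 2); apply: perm_trans pt _.
by perm_by_count.
Qed.

Lemma exceptional_lay_off (k : nat) (t : seq nat) :
  1 <= k <= size t -> sorted geq (rcons t k) -> 3 <= nth 0 t 3 ->
  exceptional (sort geq (lay_off k t)) -> exceptional (rcons t k) \/ K_realizable (rcons t k).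
Proof.
move=> /andP[k1 kt] ss t3 eu.
have pu : perm_eq (lay_off k t) (sort geq (lay_off k t)) by rewrite perm_sym perm_sort.
have [st tk] := sorted_rcons_geq ss.
have t1 : all (leq 1) (take k t) by apply/allP => x /mem_take/(allP tk) /=; lia.
have finite E : E \in finite_exceptions -> sort geq (lay_off k t) = E ->
    exceptional (rcons t k) \/ K_realizable (rcons t k).
  by move=> hE uE; apply: (finite_exception_lay_off hE) => //; rewrite ?k1 // -uE.
have star c b : c \in [:: 5; 6] -> sort geq (lay_off k t) = star3 c b ->
    exceptional (rcons t k) \/ K_realizable (rcons t k).
  move=> hc uE.
  case: b uE => [|b] uE.
    by apply: (finite (star3 c 0)) => //; move: hc; rewrite !inE => /orP[] /eqP ->.
  (* A remaining term 1 is compatible only with [k = 1], which again gives a member of the same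
     family. *)
  have [k_1|k2] : k = 1 \/ 2 <= k by lia.
    subst k; rewrite uE in pu; left.
    case: t st t3 pu {kt ss tk t1 eu uE finite} => [|x t] //.
    rewrite sorted_consE => /andP[xt st] t3.
    have x3 := nth_le_all 2 xt.
    rewrite /= in t3; rewrite /lay_off /= take0 drop0 /star3.
    move=> /perm_head_large[].
    - by move: hc; rewrite !inE; lia.
    - by rewrite all_cat !all_nseq /= !orbT.
    - by rewrite prednK //; lia.
    move=> xE pt; have {pt} -> := @perm_blocks c 0 b.+1 _ st pt.
    have -> : x = c + b.+2 by lia.
    have := exceptional_star3 b.+2 hc; congr (is_true (exceptional _)).
    rewrite /star3 /= rcons_cat; congr [:: _ & _ ++ _].
    by elim: (b) => //= n [->].
  have := lay_off_ge2 k2 tk st t3; rewrite (perm_all _ pu) uE /= all_cat all_nseq.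
  by rewrite andbF andbF.
case: (exceptionalP eu) => [h|[b]|[b]|[a [b [a2 ea h]]]].
- by apply: (finite (sort geq (lay_off k t))) => //; rewrite mem_cat h.
- exact: star.
- exact: star.
by apply: (@lay_off_star2 k a b) => //; rewrite -h.
Qed.

(** * Numbers of large terms after laying off *)

Lemma lay_off_count2 (k : nat) (t : seq nat) : sorted geq (rcons t k) ->
  3 <= nth 0 t 3 -> 2 <= nth 0 t 4 -> 5 <= count (leq 2) (lay_off k t).
Proof.
move=> /sorted_rcons_geq[]; case: t => [|t1 [|t2 [|t3 [|t4 [|t5 t]]]]] //=.
move=> /and5P[h1 h2 h3 h4 _] /and5P[k1 k2 k3 k4 /andP[k5 _]] t43 t52.
(* The first four terms are at least 3; the fifth is lowered only if [k >= 5], and then it is at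
   least 5. *)
by case: k k1 k2 k3 k4 k5 => [|[|[|[|[|k]]]]] k1 k2 k3 k4 k5; rewrite /lay_off /= ?take0 /=; lia.
Qed.

(** The count can fail only for [k <= 3], and then almost all terms are determined. *)
Lemma lay_off_count3 (k : nat) (t : seq nat) : 1 <= k -> sorted geq (rcons t k) ->
  realizable (rcons t k) -> 3 <= nth 0 t 3 -> 2 <= nth 0 t 4 ->
  [\/ 4 <= count (leq 3) (lay_off k t), exceptional (rcons t k) | K_realizable (rcons t k)].
Proof.
move=> k1 ss rs; have := realizable_even rs; have [st tk] := sorted_rcons_geq ss.
have lt := realizable_lt rs.
move: st tk lt rs; case: t ss => [|t1 [|t2 [|t3 [|t4 [|t5 t]]]]] // ss st tk lt rs ev t43 t52.
rewrite /= in t43 t52; move: st tk ev.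
rewrite !sorted_consE /= => /and5P[/andP[t12 _] /andP[t23 _] /andP[t34 _] /andP[t45 _]].
move=> /andP[t5t st].
move=> /and5P[kt1 kt2 kt3 kt4 /andP[kt5 kt]].
have t1s : t1 < (size t) + 6 by have := lt t1 (mem_head _ _); rewrite size_rcons /=; lia.
have const x : all (leq x) t -> all (geq x) t -> t = nseq (size t) x.
  move=> /allP h1 /allP h2; apply/all_pred1P/allP => y yt /=.
  by apply/eqP/anti_leq; rewrite (h1 y yt) andbT; exact: h2.
case: k k1 ss lt rs kt1 kt2 kt3 kt4 kt5 kt => [|[|[|[|k]]]] // _ ss lt rs kt1 kt2 kt3 kt4 kt5 kt.
- rewrite /lay_off /= sumn_rcons => ev.
  (* Last term 1: what remains is (3^4, 2^a, 1^b) with a positive. *)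
  have [h|[h1 h2]] : (4 <= t1 \/ 3 <= t5) \/ (t1 = 3 /\ t5 = 2) by lia.
    by apply: Or31; lia.
  have [t2_3 t3_3 t4_3] : [/\ t2 = 3, t3 = 3 & t4 = 3] by split; lia.
  subst t1 t2 t3 t4 t5; apply: Or33.
  have le3 : all (fun x => 0 < x <= 3) (rcons [:: 3, 3, 3, 3, 2 & t] 1).
    rewrite all_rcons /=; apply/allP => x xt.
    by have := allP kt x xt; have := allP t5t x xt => /=; lia.
  have c3 : count_mem 3 (rcons [:: 3, 3, 3, 3, 2 & t] 1) = 4.
    rewrite -cats1 count_cat /=; have -> : count_mem 3 t = 0 => //.
    by apply/count_memPn/negP => /(allP t5t).
  have c2 : 1 <= count_mem 2 (rcons [:: 3, 3, 3, 3, 2 & t] 1).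
    by rewrite -cats1 count_cat /=.
  have c1 : 1 <= count_mem 1 (rcons [:: 3, 3, 3, 3, 2 & t] 1).
    by rewrite -cats1 count_cat /= addn1.
  move: (le3_blocks ss le3); rewrite c3; move: (count_mem 2 _) (count_mem 1 _) c2 c1.
  move=> c2 c1 c2_1 c1_1 E; change (K_realizable (rcons [:: 3, 3, 3, 3, 2 & t] 1)); rewrite E.
  have := congr1 sumn E; rewrite sumn_rcons !sumn_cat !sumn_nseq => hsum.
  by apply: K_realizable_3_2_1 => //; move: ev hsum; rewrite /=; lia.
- rewrite /lay_off /= ?take0 ?drop0 sumn_rcons => ev.
  (* Last term 2: what remains is (3^5, 2^c), of odd sum, and (x, 3^3, 2^b). *)
  have [h|[t2_3 h]] : (4 <= t2 \/ 4 <= t1 /\ 3 <= t5) \/ (t2 = 3 /\ (t1 = 3 \/ t5 = 2)) by lia.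
    by apply: Or31; lia.
  have [t3_3 t4_3] : t3 = 3 /\ t4 = 3 by lia.
  subst t2 t3 t4.
  have [h5|t5_2] : (t1 = 3 /\ t5 = 3) \/ t5 = 2 by lia.
    case: h5 => t1_3 t5_3; subst t1 t5.
    case: (posnP (count (leq 3) t)) => [c0|c1]; last by apply: Or31; lia.
    have t2t : t = nseq (size t) 2.
      apply: const => //; apply/allP => x xt; rewrite /= leqNgt; apply/negP => x3.
      by move: c0; apply/eqP; rewrite -lt0n -has_count; apply/hasP; exists x.
    by move: ev; rewrite t2t sumn_nseq; lia.
  subst t5; rewrite (congr1 sumn (const 2 kt t5t)) sumn_nseq in ev.
  have sE : rcons [:: t1, 3, 3, 3, 2 & t] 2 = t1 :: nseq 3 3 ++ nseq (size t + 2) 2.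
    rewrite (const 2 kt t5t) size_nseq addn2 /=; congr [:: _, _, _, _, _ & _].
    by elim: (size t) => //= n ->.
  suff : exceptional (rcons [:: t1, 3, 3, 3, 2 & t] 2) \/
      K_realizable (rcons [:: t1, 3, 3, 3, 2 & t] 2).
    by case=> h1; [apply: Or32 | apply: Or33].
  rewrite sE.
  (* In the first case the first vertex is adjacent to all others. *)
  have [tmax|tlt] : t1 = size t + 5 \/ t1 < size t + 2 + 3 by lia.
    left; have := @exceptional_star2 (size t + 2) 0 ltac:(lia) ltac:(lia).
    congr (is_true (exceptional _)); rewrite /star2 cats0 tmax.
    by congr (_ :: _); lia.
  have [[t1_3 h23]|hn] : (t1 = 3 /\ (size t = 0 \/ size t = 1)) \/
      (t1 = 3 -> size t + 2 <> 2 /\ size t + 2 <> 3) by lia.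
    by left; rewrite t1_3; case: h23 => ->.
  by right; apply: K_realizable_star => //; lia.
- rewrite /lay_off /= ?take0 ?drop0 sumn_rcons => ev.
  have -> : count (leq 3) t = size t by apply/eqP; rewrite -all_count.
  (* Last term 3: what remains is (3^6) and (5, 3^5), since the sum is even. *)
  have [h|[t2_3 h]] : (4 <= t2 \/ 4 <= t1 /\ 1 <= size t \/ 2 <= size t) \/
      (t2 = 3 /\ (size t = 0 \/ t1 = 3 /\ size t = 1)) by lia.
    by apply: Or31; lia.
  have [t3_3 t4_3 t5_3] : [/\ t3 = 3, t4 = 3 & t5 = 3] by split; lia.
  subst t2 t3 t4 t5.
  move: ev; rewrite (const 3 kt t5t) sumn_nseq size_nseq => ev.
  have [h0 [h3|h3]] : size t = 0 /\ (t1 = 3 \/ t1 = 5) by lia.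
    by apply: Or32; rewrite h0 h3.
  by apply: Or32; rewrite h0 h3.
by move=> _; apply: Or31; rewrite /lay_off /=; lia.
Qed.

(** * Sufficiency by induction on the length *)

Lemma K_realizable_size5 (a b c d k : nat) : sorted geq [:: a; b; c; d; k] ->
  realizable [:: a; b; c; d; k] -> 3 <= d -> 2 <= k -> K_realizable [:: a; b; c; d; k].
Proof.
move=> ss rs d3 k2; have ev := realizable_even rs.
have a4 : a < 5 by apply: (realizable_lt rs); rewrite mem_head.
(* Laying off the 2 leaves four terms, one of which is 4. *)
have no44442 : [:: a; b; c; d; k] <> [:: 4; 4; 4; 4; 2].
  move=> E; rewrite E in rs.
  have := @realizable_lay_off 2 [:: 4; 4; 4; 4] isT rs => /realizable_lt/(_ (_ : 4 \in _)).
  by move=> /(_ isT).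
apply: K_realizable_witness; move: ss ev no44442; rewrite /= => /and5P[ab bc cd dk _].
move=> ev no.
have [ha hb hc hd hk] : [/\ a \in [:: 3; 4], b \in [:: 3; 4], c \in [:: 3; 4],
    d \in [:: 3; 4] & k \in [:: 2; 3; 4]] by rewrite !inE; split; lia.
move: hk hd hc hb ha ab bc cd dk ev no {d3 k2 a4 rs}; rewrite !inE.
move=> /or3P[] /eqP -> /orP[] /eqP -> /orP[] /eqP -> /orP[] /eqP -> /orP[] /eqP -> //.
Qed.

Lemma K_realizable_of_not_exceptional (s : seq nat) :
  sorted geq s -> all (leq 1) s -> realizable s ->
  3 <= nth 0 s 3 -> 2 <= nth 0 s 4 -> ~~ exceptional s -> K_realizable s.
Proof.
have [n] := ubnP (size s); elim: n s => // n IH s.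
case/lastP: s => [|t k] //; rewrite size_rcons ltnS => tn ss s1 rs.
have kt : k <= size t.
  by have := @realizable_lt _ k rs; rewrite mem_rcons inE eqxx size_rcons ltnS; exact.
have [st tk] := sorted_rcons_geq ss.
have k1 : 1 <= k by apply: (allP s1); rewrite mem_rcons mem_head.
rewrite !nth_rcons; have [t5|t4] := leqP 5 (size t); last first.
  case: t t4 ss rs {st tk kt s1 tn} => [|a [|b [|c [|d [|//]]]]] //= _ ss rs d3 k2 _.
  exact: K_realizable_size5.
have t4 : 3 < size t by lia.
rewrite t4 => t43 t52 nexc.
have [c3|h|//] := lay_off_count3 k1 ss rs t43 t52; last by rewrite h in nexc.
have c2 := lay_off_count2 ss t43 t52.
have [eu|neu] := boolP (exceptional (sort geq (lay_off k t))).
  have hk : 1 <= k <= size t by rewrite k1.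
  by have [h|//] := exceptional_lay_off hk ss t43 eu; rewrite h in nexc.
have pu : perm_eq (sort geq (lay_off k t)) (lay_off k t) by rewrite perm_sort.
have su : sorted geq (sort geq (lay_off k t)) by exact: sort_sorted geq_total _.
have tk1 : all (leq 1) (take k t) by apply/allP => x /mem_take/(allP tk) /=; lia.
have hs : size (lay_off k t) = size t.
  by rewrite size_cat size_map -size_cat cat_take_drop.
have Ku : K_realizable (lay_off k t).
  apply: (K_realizable_perm pu); apply: IH => //.
  - by rewrite size_sort hs.
  - rewrite (perm_all _ pu); apply/allP => x xu.
    move: xu; rewrite /lay_off mem_cat => /orP[/mapP[y yt ->]|/mem_drop/(allP tk)] /=; last lia.
    (* For [k = 1] only the first term is lowered, and it is at least 3. *)
    move: yt; case: (ltngtP 1 k) k1 => // [k2|<-] _ yt.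
      by have := allP tk y (mem_take yt) => /=; lia.
    have t03 : 3 <= nth 0 t 0.
      by apply: leq_trans t43 _; apply: all_geq_nth => //; exact: leq_trans t5.
    move: yt t03; case: (t) => [|z t'] //=; rewrite take0 inE => /eqP ->; lia.
  - by apply: (realizable_perm _ (realizable_lay_off st rs)); rewrite perm_sym.
  - by rewrite count_geq_sorted // (permP pu).
  - by rewrite count_geq_sorted // (permP pu).
have := @K_realizable_add k (lay_off k t); rewrite hs => /(_ kt Ku).
by rewrite lay_offK //; apply: K_realizable_perm; rewrite perm_sym perm_rcons.
Qed.

(** * Necessity *)

Definition vK (i : nat) : K := inord i.

Lemma degree_K (i : K) : degree i = nth 0 [:: 3; 2; 3; 3; 3] i.
Proof.
have -> : degree i = count (edge_rel K_edges i) (iota 0 5).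
  rewrite -val_enum_ord count_map /degree cardsE cardE size_filter enumT.
  apply: eq_count => j.
  by move: i j; do 2![case=> [[|[|[|[|[|?]]]]] ?] //].
by case: i => -[|[|[|[|[|]]]]].
Qed.

(** * Edges between a copy and its complement *)

Section Copy.
Variables (G : sgraph) (f : K -> G).
Hypothesis f_inj : injective f.
Hypothesis f_adj : forall i j : K, adj i j -> adj (f i) (f j).

Let U := f @: [set: K].

Lemma degree_copy (i : K) : degree i + #|[set y in ~: U | adj (f i) y]| <= degree (f i).
Proof.
rewrite /degree -(card_imset _ f_inj).
rewrite -(cardsID U [set y | adj (f i) y]); apply: leq_add; apply: subset_leq_card.
  apply/subsetP => y /imsetP[j]; rewrite inE => /f_adj a ->.
  by rewrite !inE a imset_f ?inE.
by apply/subsetP => y; rewrite !inE.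
Qed.

Lemma card_copy : #|U| = 5.
Proof. by rewrite card_imset // cardsT card_ord. Qed.

(** At most [#|~: U| - 1] neighbours of [y] lie outside the copy. *)
Lemma degree_outside (y : G) : y \notin U ->
  degree y - (#|~: U| - 1) <= \sum_(x in U) adj x y.
Proof.
move=> yU.
have -> : \sum_(x in U) adj x y = #|[set x | adj y x] :&: U|.
  rewrite -sum1_card big_mkcond [RHS]big_mkcond; apply: eq_bigr => x _ /=.
  by rewrite !inE adj_sym andbC; case: (x \in U) => //=; case: adj.
rewrite leq_subLR addnC /degree -(cardsID U [set x | adj y x]) leq_add2l.
have yC : y \in ~: U by rewrite inE.
rewrite (cardsD1 y (~: U)) yC addKn; apply: subset_leq_card; apply/subsetP => x.
rewrite !inE => /andP[xU a]; rewrite xU andbT.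
by apply: contraTneq a => ->; rewrite adj_irr.
Qed.

(* Double counting of the edges between the copy and the other vertices. *)
Lemma sum_degree_outside :
  \sum_(y in ~: U) (degree y - (#|~: U| - 1)) + 14 <= \sum_(i : K) degree (f i).
Proof.
(* Twice the 7 edges of [K]. *)
have -> : 14 = \sum_(i : K) degree i.
  by rewrite (eq_bigr _ (fun i _ => degree_K i)) !big_ord_recl big_ord0.
apply: (@leq_trans (\sum_(i : K) (#|[set y in ~: U | adj (f i) y]| + degree i))).
  rewrite big_split leq_add2r /=.
  apply: (@leq_trans (\sum_(y in ~: U) \sum_(x in U) adj x y)).
    by apply: leq_sum => y; rewrite inE; exact: degree_outside.
  rewrite exchange_big big_imset /=; last by move=> i j _ _; exact: f_inj.
  rewrite big_set /=; apply: leq_sum => i _.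
  rewrite -sum1_card [leqLHS]big_mkcond [leqRHS]big_mkcond; apply: leq_sum => y _ /=.
  by rewrite !inE; case: (y \in U) => //=; case: adj.
by apply: leq_sum => i _; rewrite addnC degree_copy.
Qed.
End Copy.

(** The double count in terms of degrees alone, hence open to a finite search: [a1] belongs to the
    vertex of degree 2 in [K], and [w] to the vertices outside the copy. *)
Lemma K_realizable_split (s : seq nat) : K_realizable s ->
  exists a0 a1 a2 a3 a4 w,
    [/\ perm_eq s ([:: a0; a1; a2; a3; a4] ++ w),
        [&& 3 <= a0, 2 <= a1, 3 <= a2, 3 <= a3 & 3 <= a4] &
        sumn [seq x - (size w - 1) | x <- w] + 14 <= a0 + a1 + a2 + a3 + a4].
Proof.
move=> [G gs [f f_inj f_adj]].
pose U := f @: [set: K].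
exists (degree (f (vK 0))), (degree (f (vK 1))), (degree (f (vK 2))), (degree (f (vK 3))),
  (degree (f (vK 4))), [seq degree y | y <- enum (~: U)].
have dK i : degree i <= degree (f i).
  exact: leq_trans (leq_addr _ _) (degree_copy f_inj f_adj i).
have enumK : enum K = [:: vK 0; vK 1; vK 2; vK 3; vK 4].
  apply: (inj_map val_inj); rewrite [LHS]val_enum_ord /=.
  by rewrite !inordK.
split.
- rewrite -(permPl gs).
  have -> : [:: degree (f (vK 0)); degree (f (vK 1)); degree (f (vK 2)); degree (f (vK 3));
    degree (f (vK 4))] = [seq degree y | y <- map f (enum K)] by rewrite enumK.
  rewrite -map_cat; apply: perm_map; apply: uniq_perm; first exact: enum_uniq.
    rewrite cat_uniq enum_uniq map_inj_uniq // enum_uniq andbT /=.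
    apply/hasPn => y; rewrite mem_enum inE; apply: contra => /mapP[i _ ->].
    by rewrite imset_f ?inE.
  move=> y; rewrite mem_cat !mem_enum !inE; symmetry; rewrite -implyNb; apply/implyP => h.
  apply: contra h => /imsetP[i _ ->]; by rewrite map_f ?mem_enum.
- do 4?[apply/andP; split];
    by [have := dK (vK 0); rewrite degree_K inordK|have := dK (vK 1); rewrite degree_K inordK
       |have := dK (vK 2); rewrite degree_K inordK|have := dK (vK 3); rewrite degree_K inordK
       |have := dK (vK 4); rewrite degree_K inordK].
have := sum_degree_outside f_inj f_adj.
rewrite -/U size_map -cardE -map_comp sumnE big_map big_enum /=.
by rewrite -[X in _ <= X -> _]big_enum /= enumK !big_cons big_nil addn0 !addnA.
Qed.

(** * The sporadic sequences *)

Definition remove_all (s a : seq nat) : seq nat := foldl (fun s x => rem x s) s a.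

Lemma perm_remove_all (s a w : seq nat) : perm_eq s (a ++ w) -> perm_eq (remove_all s a) w.
Proof.
elim: a s => //= x a IH s h; apply: IH.
have xs : x \in s by rewrite (perm_mem h) mem_head.
by rewrite -(perm_cons x) -(permPl (perm_to_rem xs)).
Qed.

(** The five chosen terms determine [w] up to order, so no search for [w] is necessary. *)
Definition split_ok (s : seq nat) (a0 a1 a2 a3 a4 : nat) : bool :=
  let w := remove_all s [:: a0; a1; a2; a3; a4] in
  [&& perm_eq s ([:: a0; a1; a2; a3; a4] ++ w),
      [&& 3 <= a0, 2 <= a1, 3 <= a2, 3 <= a3 & 3 <= a4] &
      sumn [seq x - (size w - 1) | x <- w] + 14 <= a0 + a1 + a2 + a3 + a4].

Lemma sporadic_no_split : all (fun s => let v := undup s in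
  all (fun a0 => all (fun a1 => all (fun a2 => all (fun a3 => all (fun a4 =>
    ~~ split_ok s a0 a1 a2 a3 a4) v) v) v) v) v) sporadic.
Proof. by vm_compute. Qed.

Lemma sporadic_not_K (s : seq nat) : s \in sporadic -> ~ K_realizable s.
Proof.
move=> /(allP sporadic_no_split) h /K_realizable_split[a0 [a1 [a2 [a3 [a4 [w]]]]]].
move=> [ps ge lew]; have pw := perm_remove_all ps.
have ins x : x \in [:: a0; a1; a2; a3; a4] -> x \in undup s.
  by move=> hx; rewrite mem_undup (perm_mem ps) mem_cat hx.
move: h => /allP/(_ a0 (ins _ _)) /allP/(_ a1 (ins _ _)) /allP/(_ a2 (ins _ _)).
rewrite !inE !eqxx !orbT.
move=> /(_ isT isT isT) /allP/(_ a3 (ins _ _)) /allP/(_ a4 (ins _ _)).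
rewrite !inE !eqxx !orbT.
move=> /(_ isT isT) /negP; apply; apply/and3P; split=> //.
  by rewrite (permPl ps) perm_cat2l perm_sym.
by rewrite (perm_sumn (perm_map _ pw)) (perm_size pw).
Qed.

(** * Copies in a graph with a dominating vertex *)

(* The hypothesis forces [j0] to be 0 or 2: each other vertex misses one of degree 3. *)
Lemma dominating_vertex_K (j0 : K) :
  (forall i : K, i != j0 -> ~~ adj i j0 + degree i <= 3) ->
  forall i : K, i != j0 -> ~~ adj i j0 + degree i = 3.
Proof.
move=> h i ij; apply/eqP; rewrite eqn_leq h //=.
have h0 := h (vK 0); have h3 := h (vK 3); have h4 := h (vK 4).
move: h0 h3 h4 ij; rewrite !degree_K {h}.
case: j0 i => -[|[|[|[|[|]]]]] // ? [[|[|[|[|[|]]]]] ?] //=;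
  rewrite /K5_minus_A3_adj /A3_adj -!val_eqE /= !inordK //= => h0 h3 h4 _;
  by have := h0 isT; have := h3 isT; have := h4 isT.
Qed.

Section Dominated.
Variables (G : sgraph) (f : K -> G) (u : G).
Hypothesis f_inj : injective f.
Hypothesis f_adj : forall i j : K, adj i j -> adj (f i) (f j).
Hypothesis u_adj : forall x, x != u -> adj x u.
Hypothesis le3 : forall x, x != u -> degree x <= 3.

(** Otherwise the image of vertex 3 has three neighbours in the copy and [u] as a fourth. *)
Lemma dominating_in_copy : exists j0, f j0 = u.
Proof.
have [/eqP h|h3] := boolP (f (vK 3) == u); first by exists (vK 3).
have [/existsP[j /eqP h]|] := boolP [exists j, f j == u]; first by exists j.
rewrite negb_exists => /forallP hn.
have : #|u |: f @: [set j | adj (vK 3) j]| <= #|[set y | adj (f (vK 3)) y]|.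
  apply: subset_leq_card; apply/subsetP => y; rewrite !inE => /orP[/eqP ->|/imsetP[j]].
    exact: u_adj.
  by rewrite inE => /f_adj a ->.
rewrite cardsU1 (card_imset _ f_inj).
have -> : u \notin f @: [set j | adj (vK 3) j].
  by apply/imsetP => -[j _ h]; move: (hn j); rewrite -h eqxx.
have := le3 h3; have := degree_K (vK 3); rewrite /degree inordK //= => ->; lia.
Qed.

(** The images of the neighbours of [i], together with [u], already number three, so by [le3] they
    are all the neighbours of [f i]. *)
Lemma closed_copy : exists2 j0, f j0 = u &
  forall i, i != j0 -> degree (f i) = 3 /\ [set y | adj (f i) y] \subset f @: [set: K].
Proof.
have [j0 fj0] := dominating_in_copy; exists j0 => //.
have sub i : i != j0 -> f @: (j0 |: [set j | adj i j]) \subset [set y | adj (f i) y].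
  move=> ij; apply/subsetP => y /imsetP[j]; rewrite !inE => /orP[/eqP ->|/f_adj a] -> //.
  by rewrite fj0 u_adj // -fj0 (inj_eq f_inj).
have cE i : #|f @: (j0 |: [set j | adj i j])| = ~~ adj i j0 + degree i.
  by rewrite card_imset // cardsU1 inE.
have fu i : i != j0 -> f i != u by rewrite -fj0 (inj_eq f_inj).
have le i : i != j0 -> ~~ adj i j0 + degree i <= 3.
  move=> ij; rewrite -cE; apply: leq_trans (le3 (fu i ij)).
  exact: subset_leq_card (sub i ij).
move=> i ij; have e3 := dominating_vertex_K le ij.
have /eqP E : f @: (j0 |: [set j | adj i j]) == [set y | adj (f i) y].
  by rewrite eqEcard sub // cE e3 le3 // fu.
by split; [rewrite /degree -E cE | rewrite -E; apply: imsetS; exact: subsetT].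
Qed.
End Dominated.

Lemma star_count3 (r : seq nat) : 5 <= size r -> all (geq 3) r ->
  K_realizable (size r :: r) ->
  4 <= count_mem 3 r /\
  (all (mem [:: 3; 1]) r -> count_mem 3 r = 4 \/ 7 <= count_mem 3 r).
Proof.
move=> r5 r3 [G /degrees_enum[[|u us] pvs //= [du dr]] [f f_inj f_adj]].
have : uniq (u :: us) by rewrite -(perm_uniq pvs) enum_uniq.
move=> /= /andP[uus uniq_us].
have mus x : (x \in us) = (x != u).
  have := perm_mem pvs x; rewrite mem_enum !inE; case: eqVneq => [->|_] /= h; last by rewrite -h.
  by rewrite (negbTE uus).
have dus (z : G) : z != u -> degree z \in r by rewrite -mus => zus; rewrite -dr map_f.
have le3 x : x != u -> degree x <= 3 by move=> /dus/(allP r3).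
have uN : [set y | adj u y] = ~: [set u].
  apply/eqP; rewrite eqEcard; apply/andP; split.
    by apply/subsetP => y; rewrite !inE; apply: contraTneq => ->; rewrite adj_irr.
  rewrite cardsC1 [X in _ <= X]du -dr size_map.
  by have := perm_size pvs; rewrite -cardE => -> /=.
have u_adj x : x != u -> adj x u.
  by move=> xu; have /setP/(_ x) := uN; rewrite !inE xu adj_sym.
have [j0 fj0 closed] := closed_copy f_inj f_adj u_adj le3.
pose U := f @: [set: K].
pose D := [set x | (x != u) && (degree x == 3)].
have cD : count_mem 3 r = #|D|.
  rewrite -dr count_map -size_filter cardE; apply: perm_size; apply: uniq_perm.
  - exact: filter_uniq.
  - exact: enum_uniq.
  by move=> x; rewrite mem_filter mem_enum [RHS]inE mus andbC.
have UD : U :\ u \subset D.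
  apply/subsetP => x; rewrite !inE => /andP[xu /imsetP[i _ xE]]; rewrite xu xE.
  by rewrite (closed i _).1 //; apply: contraNneq xu => ij; rewrite xE ij fj0.
have uU : u \in U by rewrite -fj0 imset_f ?inE.
have cU : #|U :\ u| = 4.
  by have := card_copy f_inj; rewrite (cardsD1 u) -/U uU => -[].
rewrite cD; split; first by rewrite -cU subset_leq_card.
move=> r31.
have [D0|[x]] := set_0Vmem (D :\: (U :\ u)).
  left; apply/eqP; rewrite eqn_leq -cU (subset_leq_card UD) andbT subset_leq_card //.
  by rewrite -setD_eq0 D0.
rewrite !inE => /andP[xU /andP[xu /eqP dx]]; rewrite xu /= in xU.
right; have cDU := cardsID (U :\ u) D; rewrite (setIidPr UD) cU in cDU.
(* A neighbour of [x] other than [u] is not in the copy, which is closed, and has degree at least 2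
   because of [u] and [x]; so its degree is 3. With [x] this makes at least three further vertices
   of degree 3. *)
have : #|[set y | adj x y]| <= #|u |: (D :\: (U :\ u)) :\ x|.
  apply: subset_leq_card; apply/subsetP => y; rewrite !inE => xy.
  case: eqVneq => //= yu.
  have yU : y \notin U.
    apply: contra xU => /imsetP[i _ yE].
    have ij : i != j0 by apply: contraNneq yu => ij; rewrite yE ij fj0.
    by apply: (subsetP (closed i ij).2); rewrite inE -yE adj_sym.
  rewrite yU /=; apply/andP; split.
    by apply: contraTneq xy => ->; rewrite adj_irr.
  have := allP r31 _ (dus y yu); rewrite !inE => /orP[-> //|/eqP dy].
  suff : 2 <= degree y by rewrite dy.
  rewrite /degree; have -> : 2 = #|[set u; x]| by rewrite cards2 eq_sym xu.
  apply: subset_leq_card; apply/subsetP => z; rewrite !inE => /orP[] /eqP ->.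
    exact: u_adj.
  by rewrite adj_sym.
rewrite -[#|[set y | adj x y]|]/(degree x) dx cardsU1.
have := cardsD1 x (D :\: (U :\ u)); rewrite !inE (negbTE xU) xu dx eqxx /=.
by case: (_ && _); lia.
Qed.

(** The values 5 and 6 of [c] fall in the gap between 4 and 7 left by [star_count3]. *)
Lemma star3_not_K (c b : nat) : 4 < c < 7 -> ~ K_realizable (star3 c b).
Proof.
move=> c57 Ks; have [] := @star_count3 (nseq c 3 ++ nseq b 1).
- by rewrite size_cat !size_nseq; lia.
- by rewrite all_cat !all_nseq /= !orbT.
- by move: Ks; rewrite /star3 size_cat !size_nseq.
move=> _; rewrite count_cat !count_nseq all_cat !all_nseq /= !orbT => /(_ isT).
lia.
Qed.

Lemma exceptional_not_K (s : seq nat) : exceptional s -> ~ K_realizable s.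
Proof.
move=> /exceptionalP[h|[b ->]|[b ->]|[a [b [a2 ea ->]]]] Ks.
- exact: sporadic_not_K h Ks.
- exact: star3_not_K Ks.
- exact: star3_not_K Ks.
(* Only three terms 3 follow the first term, and four are necessary. *)
have [] := @star_count3 (nseq 3 3 ++ nseq a 2 ++ nseq b 1).
- by rewrite !size_cat !size_nseq; lia.
- by rewrite !all_cat !all_nseq /= !orbT.
- by move: Ks; rewrite /star2 !size_cat !size_nseq addnA.
by rewrite !count_cat !count_nseq /=.
Qed.

(** * The conditions of the theorem *)

Lemma K_realizable_counts (s : seq nat) : K_realizable s ->
  4 <= count (leq 3) s /\ 5 <= count (leq 2) s.
Proof.
move=> /K_realizable_split[a0 [a1 [a2 [a3 [a4 [w [ps ge _]]]]]]].
rewrite !(permP ps) /=; lia.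
Qed.

(** With [a = m - k] and [b = k - 4], the bounds on [k] and the equal parities say that [a] is even
    and at least 2. *)
Lemma exceptional_conditions (p : seq nat) (m := size p) :
  ~~ exceptional p <->
  (6 <= m -> forall k : nat, 4 <= k <= m - 2 -> odd m = odd k ->
     p <> m.-1 :: nseq 3 3 ++ nseq (m - k) 2 ++ nseq (k - 4) 1) /\
  p \notin sporadic ++ [:: m.-1 :: nseq 5 3 ++ nseq (m - 6) 1;
                          m.-1 :: nseq 6 3 ++ nseq (m - 7) 1].
Proof.
split=> [/negP nexc|[no2 no3]].
  split=> [m6 k km okm pE|].
    apply: nexc; rewrite pE.
    have := @exceptional_star2 (m - k) (k - 4) ltac:(lia) ltac:(lia).
    by rewrite /star2; have -> : 3 + (m - k) + (k - 4) = m.-1 by lia.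
  have star c : c \in [:: 5; 6] -> p <> m.-1 :: nseq c 3 ++ nseq (m - c.+1) 1.
    move=> hc pE; apply: nexc.
    have mE : m = (c + (m - c.+1)).+1 by rewrite {1}/m pE /= size_cat !size_nseq.
    have := exceptional_star3 (m - c.+1) hc.
    by rewrite /star3 -[c + _]/((c + (m - c.+1)).+1.-1) -mE -pE.
  rewrite mem_cat negb_or; apply/andP; split.
    by apply: contraPN nexc => h; rewrite /exceptional h.
  by rewrite !inE negb_or; apply/andP; split; apply/eqP; exact: star.
apply/negP => /exceptionalP[h|[b pE]|[b pE]|[a [b [a2 ea pE]]]].
- by rewrite mem_cat h in no3.
- have mE : m = 6 + b by rewrite /m pE size_star3.
  by rewrite mE addKn pE mem_cat !inE eqxx !orbT in no3.
- have mE : m = 7 + b by rewrite /m pE size_star3.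
  by rewrite mE addKn pE mem_cat !inE eqxx !orbT in no3.
have mE : m = 4 + a + b by rewrite /m pE size_star2.
apply: (no2 _ (4 + b)); rewrite mE; try lia.
have -> : 4 + a + b - (4 + b) = a by lia.
by rewrite addKn pE.
Qed.

(* Terms are indexed from 0: d_4 and d_5 are [nth 0 d 3] and [nth 0 d 4].
   The exceptional sequences are compared with [d] up to trailing zeros;
   when d_n >= 1, [p] is [d] and [m] is [n].  Those of the form (m-1, 3^5, ...)
   and (m-1, 3^6, ...) have length m only if m >= 6, resp. m >= 7, so the
   truncated subtractions are harmless. *)
Theorem theorem3p2 (n : nat) (d : n.-tuple nat) (n_ge5 : 5 <= n)
    (d_noninc : sorted geq d) (d_graphic : graphic d) :
  potentially_graphic K5_minus_A3 d <->
  let p := positive_terms d in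
  let m := size p in
  [/\ 3 <= nth 0 d 3 /\ 2 <= nth 0 d 4,
      6 <= m -> forall k : nat, 4 <= k <= m - 2 -> odd m = odd k ->
        p <> m.-1 :: nseq 3 3 ++ nseq (m - k) 2 ++ nseq (k - 4) 1
    & p \notin
        [:: nseq 4 3 ++ nseq 2 2;
            nseq 6 3;
            nseq 4 3 ++ nseq 3 2;
            nseq 6 3 ++ nseq 1 2;
            4 :: nseq 6 3;
            nseq 7 3 ++ nseq 1 1;
            nseq 8 3;
            m.-1 :: nseq 5 3 ++ nseq (m - 6) 1;
            m.-1 :: nseq 6 3 ++ nseq (m - 7) 1]].
Proof.
set p := positive_terms d; set m := size p => /=.
have sp : sorted geq p by apply: sorted_filter => //; exact: geq_trans.
have p1 : all (leq 1) p by exact: filter_all.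
have rp : realizable p.
  have [G /(realizationP _ d_noninc) hG] := d_graphic.
  by apply: realizable_positive; exists G.
(* Zero terms do not change the number of terms above a positive bound. *)
have nthE a i : 0 < a -> (a <= nth 0 d i) = (a <= nth 0 p i).
  move=> a0; rewrite !count_geq_sorted // count_filter; congr (_ < _).
  by apply: eq_count => x /=; case: (leqP a x) => //= ax; rewrite (leq_trans a0 ax).
have KE : potentially_graphic K5_minus_A3 d <-> K_realizable p.
  split=> [[G /(realizationP _ d_noninc) hG GK]|/K_realizable_of_positive[G hG GK]].
    by apply: K_realizable_positive; exists G.
  by exists G => //; exact/realizationP.
rewrite !nthE //; split=> [/KE Kp|[[h3 h2] no2 no3]].
  have [c3 c2] := K_realizable_counts Kp.
  have /exceptional_conditions[no2 no3] : ~~ exceptional p.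
    by apply/negP => /exceptional_not_K.
  by split=> //; rewrite !count_geq_sorted.
apply/KE/K_realizable_of_not_exceptional => //.
exact/exceptional_conditions.
Qed.
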